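(* Let $T\ge1$, $n\ge2$, $d\ge1$, $\tau\in\{1,\dots,T\}$, $\boldsymbol\mu\in\mathbb{R}^d$, $\boldsymbol\Sigma=\mathrm{diag}(\sigma_1^2,\dots,\sigma_d^2)$ with all $\sigma_j>0$, and $\mathbf{z}^*\in\mathbb{R}^d$. Under $\mathbf{H_0}$ the points $\mathbf{X}_{t,k}\in\mathbb{R}^d$ ($t\le T$, $k\le n$) are i.i.d. $\mathcal{N}(\boldsymbol\mu,\boldsymbol\Sigma)$. Let $\mathbf{N_\tau}=\frac1n\sum_{k=1}^n\mathbf{X}_{\tau,k}-\boldsymbol\mu$, $m^*=(\mathbf{z}^*-\boldsymbol\mu)^\top\boldsymbol\Sigma^{-1}(\mathbf{z}^*-\boldsymbol\mu)$ and \[ \log\mathrm{LR}_\tau=-\frac d2\log\Big(\frac{n-1}{n}\Big)-\frac{n}{2(n-1)}\mathbf{N_\tau}^\top\boldsymbol\Sigma^{-1}\mathbf{N_\tau}+\frac{n}{n-1}\mathbf{N_\tau}^\top\boldsymbol\Sigma^{-1}(\mathbf{z}^*-\boldsymbol\mu)-\frac{m^*}{2(n-1)}. \] Let $\alpha(\gamma)=\mathbb{P}_{\mathbf{H_0}}(\log\mathrm{LR}_\tau\ge\gamma)$, $\gamma_{\max}=\frac12\big[m^*-d\log\big(\frac{n-1}{n}\big)\big]$ and $R^2(\gamma)=\frac{2(n-1)}{n}\big[\frac{m^*}{2}-\gamma-\frac d2\log\big(\frac{n-1}{n}\big)\big]$. Then for every $\gamma\le\gamma_{\max}$, \[ \alpha(\gamma)=F_{\chi^2_d(nm^*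 )}\big(n\,R^2(\gamma)\big), \] where $F_{\chi^2_d(\lambda)}$ is the cumulative distribution function of the non-central chi-squared distribution with $d$ degrees of freedom and non-centrality parameter $\lambda$.
   Context: $\log\mathrm{LR}_\tau$ is the log likelihood ratio for testing whether the target $\mathbf{z}^*$ was inserted in batch $\tau$; $\alpha(\gamma)$ is the Type I error of the test rejecting when $\log\mathrm{LR}_\tau\ge\gamma$. *)

(* Defs.v *)
From HB Require Import structures.
From mathcomp Require Import all_boot all_order all_algebra.
From mathcomp Require Import all_classical all_reals all_analysis.
Set Implicit Arguments. Unset Strict Implicit. Unset Printing Implicit Defensive.
Import Order.TTheory GRing.Theory Num.Theory.
Import numFieldNormedType.Exports.
Local Open Scope classical_set_scope.
Local Open Scope ring_scope.

Definition mutually_independent {d} {Omega : measurableType d} {R : realType}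
  (P : probability Omega R) (I : finType) (Y : I -> Omega -> R) : Prop :=
  forall B : I -> set R, (forall i, measurable (B i)) ->
    P (\bigcap_(i in [set: I]) (Y i @^-1` B i)) =
    (\big[*%E/1%E]_(i : I) P (Y i @^-1` B i))%E.

(* Iterated integral of f : seq R -> R against k independent N(0,1)
   coordinates (the standard Gaussian measure on R^k, via Fubini order). *)
Fixpoint gauss_iter {R : realType} (k : nat) (f : seq R -> R) : R :=
  match k with
  | 0 => f [::]
  | k'.+1 => Rintegral (@lebesgue_measure R) setT
      (fun z => normal_pdf 0 1 z * gauss_iter k' (fun s => f (z :: s)))
  end.

(* CDF of the non-central chi-squared distribution with k degrees of freedom
   and non-centrality lambda: P( sum_{i<k} (Z_i + a_i)^2 <= x ) with Z_i iid
   N(0,1) and a = (sqrt lambda, 0, ..., 0), so that sum a_i^2 = lambda. *)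
Definition ncchi2_cdf {R : realType} (k : nat) (lambda x : R) : R :=
  gauss_iter k (fun s =>
    if (\sum_(i < k) (nth 0 s i + (if i == 0%N :> nat then Num.sqrt lambda else 0)) ^+ 2
        <= x) then 1 else 0).

Definition diag_form {R : realType} (dim : nat) (sigma u v : 'I_dim -> R) : R :=
  \sum_(j < dim) u j * v j / sigma j ^+ 2.

Definition N_tau {Omega : Type} {R : realType} (T n dim : nat)
  (X : 'I_T -> 'I_n -> 'I_dim -> Omega -> R) (mu : 'I_dim -> R) (tau : 'I_T)
  (w : Omega) : 'I_dim -> R :=
  fun j => (n%:R)^-1 * (\sum_(k < n) X tau k j w) - mu j.

Definition mstar {R : realType} (dim : nat) (sigma mu z : 'I_dim -> R) : R :=
  diag_form sigma (fun j => z j - mu j) (fun j => z j - mu j).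

Definition logLR {Omega : Type} {R : realType} (T n dim : nat)
  (X : 'I_T -> 'I_n -> 'I_dim -> Omega -> R) (mu sigma z : 'I_dim -> R)
  (tau : 'I_T) (w : Omega) : R :=
  let N := N_tau X mu tau w in
  - (dim%:R / 2) * ln ((n%:R - 1) / n%:R)
  - n%:R / (2 * (n%:R - 1)) * diag_form sigma N N
  + n%:R / (n%:R - 1) * diag_form sigma N (fun j => z j - mu j)
  - mstar sigma mu z / (2 * (n%:R - 1)).

Definition gamma_max {R : realType} (n dim : nat) (m : R) : R :=
  (m - dim%:R * ln ((n%:R - 1) / n%:R)) / 2.

Definition Rsq {R : realType} (n dim : nat) (m gamma : R) : R :=
  2 * (n%:R - 1) / n%:R * (m / 2 - gamma - dim%:R / 2 * ln ((n%:R - 1) / n%:R)).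

(* Main.v *)
(* Completing the square turns [gamma <= logLR] into
   [\sum_j (Z_j - a_j)^2 <= n R^2], where [Z_j] is the standardized sample mean of coordinate [j] and
   [\sum_j a_j^2 = n m*].  The [Z_j] are independent standard normal variables,
   so the probability depends on [a] only through its norm because the standard
   Gaussian measure is rotation invariant.  Only plane rotations are needed:
   these move the shift into the first coordinate two coordinates at a time, and
   also show that a sum of independent normals is normal.  A plane rotation is a
   product of three shears, and a shear preserves the plane Lebesgue integral by
   Tonelli and the translation invariance of the line. *)

Require Import Defs.
From HB Require Import structures.
From mathcomp Require Import all_boot all_order all_algebra.
From mathcomp Require Import all_classical all_reals all_analysis.
From mathcomp Require Import measurable_realfun ring lra.
Set Implicit Arguments. Unset Strict Implicit. Unset Printing Implicit Defensive.
Import Order.TTheory GRing.Theory Num.Theory.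
Import numFieldNormedType.Exports.
Local Open Scope classical_set_scope.
Local Open Scope ring_scope.

(* [pushforward m f] is a measure only given a proof that [f] is measurable;
   packing that proof lets the measure be passed as an argument. *)
Definition image_measure d d' (T1 : measurableType d) (T2 : measurableType d')
    (R : realType) (m : {measure set T1 -> \bar R}) (f : T1 -> T2)
    (mf : measurable_fun setT f) : {measure set T2 -> \bar R}.
Proof. by refine (pushforward m f : {measure set T2 -> \bar R}). Defined.

(** * Affine maps, shears and rotations under Lebesgue measure *)

Section lebesgue_affine.
Context {R : realType}.
(* [lebesgue_measure] and [normal_prob] are measures on [measurableTypeR R]; its
   measurable sets are those of [R], but its display is different. *)
Local Notation RT := (measurableTypeR R).
Local Notation leb := (@lebesgue_measure R).

Lemma measurable_affine (m s : R) :
  measurable_fun [set: R] (fun x : R => m + s * x).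
Proof. by apply: measurable_funD => //; exact: measurable_funM. Qed.

(** The right side is a measure in [A] that agrees with length on half-open intervals, so uniqueness
    of Lebesgue measure applies. *)
Lemma lebesgue_measure_affine (m s : R) (s0 : 0 < s) (A : set RT) :
  measurable A ->
  leb A = (s%:E * leb ((fun x => m + s * x)%R @^-1` A))%E.
Proof.
move=> mA.
pose mu : {measure set RT -> \bar R} := mscale (NngNum (ltW s0))
  (@image_measure _ _ RT RT _ leb _ (measurable_affine m s)).
rewrite (@lebesgue_measure_unique _ mu)// => _ [[a b] /= ab <-].
rewrite /mscale /= /pushforward /=.
have -> : (fun x => m + s * x) @^-1` [set` `]a, b]] =
    [set` `](a - m) / s, (b - m) / s]].
  apply/seteqP; split => x /=; rewrite !in_itv /= ltr_pdivrMr// ler_pdivlMr//;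
   by rewrite ltrBlDl lerBrDl mulrC.
rewrite !lebesgue_measure_itv /= !lte_fin ltr_pM2r ?invr_gt0// ltrD2r.
case: ifP => _; last by rewrite mule0.
by rewrite -!EFinB -EFinM; congr EFin; field; rewrite gt_eqF.
Qed.

Lemma ge0_integral_lebesgue_affine (m s : R) (f : RT -> \bar R) : 0 < s ->
  measurable_fun setT f -> (forall x, (0 <= f x)%E) ->
  (\int[leb]_x f x = s%:E * \int[leb]_x f (m + s * x)%R)%E.
Proof.
move=> s0 mf f0; have mg := measurable_affine m s.
rewrite (eq_measure_integral (mscale (NngNum (ltW s0))
  (@image_measure _ _ RT RT _ leb _ mg))); last first.
  by move=> A mA _; exact: lebesgue_measure_affine.
rewrite ge0_integral_mscale//; congr (_ * _)%E.
by rewrite ge0_integral_pushforward.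
Qed.

Lemma ge0_integral_lebesgue_shift (m : R) (f : RT -> \bar R) :
  measurable_fun setT f -> (forall x, (0 <= f x)%E) ->
  (\int[leb]_x f (x + m)%R = \int[leb]_x f x)%E.
Proof.
move=> mf f0; rewrite [RHS](ge0_integral_lebesgue_affine m ltr01)// mul1e.
by apply: eq_integral => x _; rewrite mul1r addrC.
Qed.

Lemma measurable_shear_fst (p : R) :
  measurable_fun setT (fun z : RT * RT => (z.1 + p * z.2 : RT, z.2)).
Proof.
apply/measurable_fun_pair => //; apply: measurable_funD => //.
exact: measurable_funM.
Qed.

Lemma measurable_shear_snd (p : R) :
  measurable_fun setT (fun z : RT * RT => (z.1, z.2 + p * z.1)).
Proof.
apply/measurable_fun_pair => //; apply: measurable_funD => //.
exact: measurable_funM.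
Qed.

Lemma ge0_integral_shear_snd (p : R) (f : RT * RT -> \bar R) :
  measurable_fun setT f -> (forall z, (0 <= f z)%E) ->
  (\int[leb]_x \int[leb]_y f (x, y + p * x)%R =
   \int[leb]_x \int[leb]_y f (x, y))%E.
Proof.
move=> mf f0; apply: eq_integral => x _.
rewrite (ge0_integral_lebesgue_shift (p * x) (f := fun y => f (x, y)))//.
exact: measurableT_comp.
Qed.

Lemma ge0_integral_shear_fst (p : R) (f : RT * RT -> \bar R) :
  measurable_fun setT f -> (forall z, (0 <= f z)%E) ->
  (\int[leb]_x \int[leb]_y f (x + p * y, y)%R =
   \int[leb]_x \int[leb]_y f (x, y))%E.
Proof.
move=> mf f0.
rewrite (fubini_tonelli (m1 := leb) (m2 := leb)
  (fun z => f (z.1 + p * z.2 : RT, z.2)))//=; last first.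
  by apply: measurableT_comp => //; exact: measurable_shear_fst.
rewrite [RHS](fubini_tonelli (m1 := leb) (m2 := leb) f)//.
apply: eq_integral => y _.
rewrite (ge0_integral_lebesgue_shift (p * y) (f := fun x => f (x, y)))//.
exact: measurableT_comp.
Qed.

Lemma ge0_integral_rotation (c s : R) (f : RT * RT -> \bar R) :
  c ^+ 2 + s ^+ 2 = 1 -> c != -1 ->
  measurable_fun setT f -> (forall z, (0 <= f z)%E) ->
  (\int[leb]_x \int[leb]_y f (c * x + s * y, - s * x + c * y)%R =
   \int[leb]_x \int[leb]_y f (x, y))%E.
Proof.
move=> cs1 cN1 mf f0.
(* [[c, s], [-s, c]] = [[1, p], [0, 1]] [[1, 0], [-s, 1]] [[1, p], [0, 1]] *)
have c1 : 1 + c != 0 by rewrite addrC addr_eq0.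
(* For [c] and [s] the cosine and sine of an angle, this is the tangent of the half angle; it is
   finite because [c != -1]. *)
pose p := s / (1 + c).
have mf1 : measurable_fun setT (fun z : RT * RT => f (z.1 + p * z.2 : RT, z.2)).
  by apply: measurableT_comp => //; exact: measurable_shear_fst.
pose g (z : RT * RT) := f (z.1 + p * (z.2 + - s * z.1), z.2 + - s * z.1).
have mg : measurable_fun setT g.
  have := measurableT_comp mf1 (measurable_shear_snd (- s)); exact.
rewrite -[RHS](ge0_integral_shear_fst p)//.
rewrite -(ge0_integral_shear_snd (- s)
  (f := fun z => f (z.1 + p * z.2 : RT, z.2)))//.
rewrite -(ge0_integral_shear_fst p (f := g))//; last by move=> z; exact: f0.
apply: eq_integral => x _; apply: eq_integral => y _; rewrite /g /=.
have sE : s ^+ 2 = (1 - c) * (1 + c) by lra.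
have ps : 1 - p * s = c by rewrite /p mulrAC -expr2 sE mulfK// subKr.
have pc : p * (1 + c) = s by rewrite /p mulfVK.
congr (f (_, _)).
  transitivity ((1 - p * s) * x + (p * (1 + (1 - p * s))) * y); last by ring.
  by rewrite ps pc.
transitivity (- s * x + (1 - p * s) * y); last by ring.
by rewrite ps.
Qed.

End lebesgue_affine.

(** * Normal laws: densities and standardization *)

Section standard_normal.
Context {R : realType}.
Local Notation RT := (measurableTypeR R).
Local Notation leb := (@lebesgue_measure R).
Local Notation nu := (@normal_prob R 0 1).

Lemma integral_normal_prob (m s : R) (f : RT -> \bar R) :
  (normal_prob m s).-integrable setT f ->
  (\int[normal_prob m s]_x f x = \int[leb]_x (f x * (normal_pdf m s x)%:E))%E.
Proof.
move=> intf; have mf := measurable_int _ intf.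
rewrite -(Radon_Nikodym_change_of_variables (@normal_prob_dominates _ m s))//=.
apply: ae_eq_integral => //.
- apply: emeasurable_funM => //; apply: (measurable_int leb).
  by apply: Radon_Nikodym_integrable; exact: normal_prob_dominates.
- apply: emeasurable_funM => //=; apply/measurableT_comp => //=.
  exact: measurable_normal_pdf.
- apply: ae_eqe_mul2l => /=.
  rewrite Radon_NikodymE//=; first exact: normal_prob_dominates.
  move=> dom; case: cid => /= h [h1 h2 h3].
  (* The Radon-Nikodym derivative and the density have equal integrals over every measurable set,
     hence agree almost everywhere. *)
  apply: integral_ae_eq => //=.
  + by apply/measurableT_comp => //; exact: measurable_normal_pdf.
  + by move=> E E01 mE; rewrite -h3.
Qed.

Lemma integral_le1 (P : probability RT R) (f : RT -> \bar R) :
  measurable_fun setT f -> (forall x, (0 <= f x <= 1)%E) ->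
  (0 <= \int[P]_x f x <= 1)%E.
Proof.
move=> mf f01; apply/andP; split.
  by apply: integral_ge0 => x _; case/andP: (f01 x).
rewrite -[leRHS](@probability_setT _ _ _ P) -[leRHS]mul1e -integral_cst//.
by apply: ge0_le_integral => // x _; case/andP: (f01 x).
Qed.

Lemma integrable_le1 (P : probability RT R) (f : RT -> \bar R) :
  measurable_fun setT f -> (forall x, (0 <= f x <= 1)%E) ->
  P.-integrable setT f.
Proof.
move=> mf f01; apply/integrableP; split => //.
rewrite (eq_integral f); last first.
  by move=> x _; rewrite gee0_abs//; case/andP: (f01 x).
by have /andP[_ h] := integral_le1 P mf f01; rewrite (le_lt_trans h)// ltry.
Qed.

Lemma normal_pdf01E (x : R) :
  normal_pdf 0 1 x = normal_peak 1 * expR (- x ^+ 2 / 2).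
Proof.
by rewrite normal_pdfE ?oner_eq0// /normal_fun subr0 expr1n.
Qed.

Lemma normal_pdf_affine (m s x : R) : 0 < s ->
  s * normal_pdf m s (m + s * x) = normal_pdf 0 1 x.
Proof.
move=> s0; rewrite normal_pdf01E normal_pdfE ?gt_eqF// mulrA; congr (_ * _).
  rewrite /normal_peak expr1n mul1r -mulrnAr sqrtrM ?sqr_ge0// sqrtr_sqr.
  by rewrite gtr0_norm// invfM mulrA divff ?mul1r// gt_eqF.
rewrite /normal_fun; congr expR; rewrite addrAC subrr add0r -mulr_natr.
by field; rewrite gt_eqF.
Qed.

(** Reduces every normal law to [nu], so that rotation invariance is only needed for the standard
    one. *)
Lemma normal_prob_affine (m s : R) (B : set R) : 0 < s -> measurable B ->
  normal_prob m s B = nu ((fun x => m + s * x) @^-1` B).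
Proof.
move=> s0 mB; rewrite /normal_prob.
have mA : measurable ((fun x : R => m + s * x) @^-1` B).
  by rewrite -[X in measurable X]setTI; exact: measurable_affine.
rewrite integral_mkcond [RHS]integral_mkcond.
rewrite (ge0_integral_lebesgue_affine m s0); first last.
- by apply: erestrict_ge0 => x _; rewrite lee_fin normal_pdf_ge0.
- apply/(measurable_restrictT _ _).1 => //.
  apply/measurable_funTS/measurableT_comp => //; exact: measurable_normal_pdf.
rewrite -ge0_integralZl//=; first last.
- by rewrite lee_fin ltW.
- by move=> x _; apply: erestrict_ge0 => y _; rewrite lee_fin normal_pdf_ge0.
- apply: (measurableT_comp (f := (fun x => (normal_pdf m s x)%:E) \_ B)).
    apply/(measurable_restrictT _ _).1 => //.
    apply/measurable_funTS/measurableT_comp => //; exact: measurable_normal_pdf.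
  exact: measurable_affine.
apply: eq_integral => x _; rewrite /patch.
have -> : (x \in (fun x0 : R => m + s * x0) @^-1` B) = (m + s * x \in B).
  by apply/idP/idP; rewrite !inE.
case: ifP => _; last by rewrite mule0.
by rewrite -EFinM normal_pdf_affine.
Qed.

End standard_normal.

(** * Rotation invariance of the standard Gaussian measure on the plane *)

Section standard_normal_rotation.
Context {R : realType}.
Local Notation RT := (measurableTypeR R).
Local Notation leb := (@lebesgue_measure R).
Local Notation nu := (@normal_prob R 0 1).

Lemma integral_normal_prob2 (h : RT * RT -> \bar R) :
  measurable_fun setT h -> (forall z, (0 <= h z <= 1)%E) ->
  (\int[nu]_x \int[nu]_y h (x, y) =
   \int[leb]_x \int[leb]_y
     (h (x, y) * (normal_pdf 0 1 x * normal_pdf 0 1 y)%:E))%E.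
Proof.
move=> mh h01.
have mhx x : measurable_fun setT (fun y => h (x, y)) by exact: measurableT_comp.
rewrite integral_normal_prob; last first.
  apply: integrable_le1 => [|x]; last exact: integral_le1.
  apply: (measurable_fun_fubini_tonelli_F (m2 := nu) h mh).
  by move=> z; case/andP: (h01 z).
apply: eq_integral => x _; rewrite integral_normal_prob; last first.
  by apply: integrable_le1 => // y; exact: h01.
rewrite -ge0_integralZr//; first last.
- by rewrite lee_fin normal_pdf_ge0.
- move=> y _; apply: mule_ge0; first by case/andP: (h01 (x, y)).
  by rewrite lee_fin normal_pdf_ge0.
- apply: emeasurable_funM => //.
  apply: measurableT_comp => //; exact: measurable_normal_pdf.
by apply: eq_integral => y _; rewrite -muleA -EFinM mulrC.
Qed.

Lemma measurable_rotation (c s : R) : measurable_fun setT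
  (fun z : RT * RT => (c * z.1 + s * z.2, - s * z.1 + c * z.2) : RT * RT).
Proof.
by apply/measurable_fun_pair; apply: measurable_funD; exact: measurable_funM.
Qed.

Let integral_normal_prob_rotation_neq (c s : R) (h : RT * RT -> \bar R) :
  c ^+ 2 + s ^+ 2 = 1 -> c != -1 ->
  measurable_fun setT h -> (forall z, (0 <= h z <= 1)%E) ->
  (\int[nu]_x \int[nu]_y h (c * x + s * y, - s * x + c * y)%R =
   \int[nu]_x \int[nu]_y h (x, y))%E.
Proof.
move=> cs1 cN1 mh h01.
pose g (z : RT * RT) := (h z * (normal_pdf 0 1 z.1 * normal_pdf 0 1 z.2)%:E)%E.
have mg : measurable_fun setT g.
  apply: emeasurable_funM => //; apply: measurableT_comp => //.
  by apply: measurable_funM; apply: measurableT_comp => //;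
    exact: measurable_normal_pdf.
have g0 z : (0 <= g z)%E.
  apply: mule_ge0; first by case/andP: (h01 z).
  by rewrite lee_fin mulr_ge0 ?normal_pdf_ge0.
rewrite (integral_normal_prob2
  (h := fun z => h (c * z.1 + s * z.2, - s * z.1 + c * z.2)))//; last first.
  exact: (measurableT_comp mh (measurable_rotation c s)).
rewrite [RHS](integral_normal_prob2 mh h01).
rewrite -[RHS](ge0_integral_rotation cs1 cN1 mg g0).
apply: eq_integral => x _; apply: eq_integral => y _.
rewrite /g /= !normal_pdf01E; congr (_ * _%:E)%E.
rewrite [LHS]mulrACA [RHS]mulrACA -!expRD; congr (_ * expR _).
(* The joint density depends only on the squared norm, which the rotation preserves. *)
transitivity (- (c ^+ 2 + s ^+ 2) * (x ^+ 2 + y ^+ 2) / 2); last by field.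
by rewrite cs1; field.
Qed.

Lemma integral_normal_prob_rotation (c s : R) (h : RT * RT -> \bar R) :
  c ^+ 2 + s ^+ 2 = 1 ->
  measurable_fun setT h -> (forall z, (0 <= h z <= 1)%E) ->
  (\int[nu]_x \int[nu]_y h (c * x + s * y, - s * x + c * y)%R =
   \int[nu]_x \int[nu]_y h (x, y))%E.
Proof.
move=> cs1 mh h01; have [c1|] := eqVneq c (-1); last first.
  by move=> cN1; exact: integral_normal_prob_rotation_neq.
have s0 : s = 0.
  by move: cs1; rewrite c1 sqrrN expr1n -[RHS]addr0 => /addrI/eqP;
    rewrite sqrf_eq0 => /eqP.
(* The half turn escapes the shear factorization; it is obtained as two quarter turns. *)
have rot1 : 0 ^+ 2 + 1 ^+ 2 = 1 :> R by ring.
have rot1N : 0 != -1 :> R by rewrite eq_sym oppr_eq0 oner_eq0.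
rewrite -[RHS](integral_normal_prob_rotation_neq rot1 rot1N mh h01).
rewrite -[RHS](integral_normal_prob_rotation_neq rot1 rot1N
  (h := fun z => h (0 * z.1 + 1 * z.2, - 1 * z.1 + 0 * z.2)))//; last first.
  exact: (measurableT_comp mh (measurable_rotation 0 1)).
apply: eq_integral => x _; apply: eq_integral => y _ /=.
by rewrite c1 s0; congr (h (_, _)); ring.
Qed.

(** The half turn of the plane negates the first coordinate; applied to a function of that
    coordinate alone, the second one integrates out. *)
Lemma integral_normal_prob_opp (f : RT -> \bar R) :
  measurable_fun setT f -> (forall x, (0 <= f x <= 1)%E) ->
  (\int[nu]_x f (- x)%R = \int[nu]_x f x)%E.
Proof.
move=> mf f01.
have nu_cst (t : \bar R) : (\int[nu]_y t = t)%E.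
  by rewrite integral_cst// [X in (_ * X)%E]probability_setT mule1.
have rot : (- 1) ^+ 2 + 0 ^+ 2 = 1 :> R by ring.
have := @integral_normal_prob_rotation _ _ (fun z => f z.1) rot.
move=> /(_ (measurableT_comp mf measurable_fst)) /(_ (fun z => f01 z.1)) /=.
under [X in _ = X -> _]eq_integral do rewrite nu_cst.
move=> <-; apply: eq_integral => x _; rewrite -[LHS]nu_cst.
by apply: eq_integral => y _; congr f; ring.
Qed.

End standard_normal_rotation.

(** * The law of a sum of squares of shifted standard normals *)

Section shifted_chi2.
Context {R : realType}.
Local Notation RT := (measurableTypeR R).
Local Notation nu := (@normal_prob R 0 1).

(* The probability of [\sum_i (Z_i + l_i) ^+ 2 <= r] for i.i.d. N(0,1) [Z_i]. *)
Fixpoint shifted_chi2_cdf (l : seq R) (r : R) : \bar R :=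
  match l with
  | [::] => (if 0 <= r then 1 else 0)%:E
  | a :: l' => (\int[nu]_x shifted_chi2_cdf l' (r - (x + a) ^+ 2)%R)%E
  end.

Lemma measurable_sub_sqr (a : R) : measurable_fun setT
  (fun z : RT * RT => z.1 - (z.2 + a) ^+ 2 : RT).
Proof.
apply: measurable_funB => //; apply: measurable_funX.
exact: measurable_funD.
Qed.

(** The two claims share one induction: nonnegativity makes the next integral measurable by Tonelli,
    and measurability is needed to bound it. *)
Lemma shifted_chi2_cdf_measurable_le1 (l : seq R) :
  measurable_fun setT (shifted_chi2_cdf l : RT -> \bar R) /\
  (forall r, (0 <= shifted_chi2_cdf l r <= 1)%E).
Proof.
elim: l => [|a l [mQ Q01]] /=.
  split; last by move=> r; case: ifP; rewrite !lee_fin ?lexx ?ler01.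
  apply: measurableT_comp => //.
  apply: measurable_fun_ifT => //.
  exact: measurable_fun_ler.
have mQ2 : measurable_fun setT
    (fun z : RT * RT => shifted_chi2_cdf l (z.1 - (z.2 + a) ^+ 2)).
  exact: (measurableT_comp mQ (measurable_sub_sqr a)).
split.
  apply: (measurable_fun_fubini_tonelli_F (m2 := nu) _ mQ2) => z.
  by case/andP: (Q01 (z.1 - (z.2 + a) ^+ 2)).
move=> r; apply: integral_le1 => [|x]; last exact: Q01.
exact: (measurableT_comp mQ2 (pair1_measurable r)).
Qed.

Lemma measurable_shifted_chi2_cdf l :
  measurable_fun setT (shifted_chi2_cdf l : RT -> \bar R).
Proof. by have [] := shifted_chi2_cdf_measurable_le1 l. Qed.

Lemma shifted_chi2_cdf_le1 l r : (0 <= shifted_chi2_cdf l r <= 1)%E.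
Proof. by have [_] := shifted_chi2_cdf_measurable_le1 l. Qed.

Lemma shifted_chi2_cdf_fin_num l r : shifted_chi2_cdf l r \is a fin_num.
Proof.
have /andP[h0 h1] := shifted_chi2_cdf_le1 l r.
by rewrite ge0_fin_numE// (le_lt_trans h1)// ltry.
Qed.

Lemma measurable_shifted_chi2_cdf_sub_sqr l (a r : R) : measurable_fun setT
  (fun x : RT => shifted_chi2_cdf l (r - (x + a) ^+ 2)).
Proof.
apply: (measurableT_comp (measurable_shifted_chi2_cdf l)).
exact: (measurableT_comp (measurable_sub_sqr a) (pair1_measurable r)).
Qed.

(** By induction the shift of the tail sits in its first coordinate, as [rho]; one plane rotation
    then merges [a] and [rho] into a single shift of the same norm. *)
Let shifted_chi2_cdf_cons (a : R) (l : seq R) (r : R) :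
  shifted_chi2_cdf (a :: l) r =
  shifted_chi2_cdf
    (Num.sqrt (\sum_(b <- a :: l) b ^+ 2) :: nseq (size l) 0) r.
Proof.
elim: l a r => [|b l IH] a r.
  (* With one coordinate the norm is the absolute value of [a]; a negative shift is flipped by the
     symmetry of [nu]. *)
  rewrite big_seq1 sqrtr_sqr /=; have [//|a0] := ger0P a.
  rewrite -[RHS](integral_normal_prob_opp
    (measurable_shifted_chi2_cdf_sub_sqr [::] (- a) r)
    (fun x => shifted_chi2_cdf_le1 [::] (r - (x - a) ^+ 2))) /=.
  apply: eq_integral => x _.
  by have -> : (- x - a) ^+ 2 = (x + a) ^+ 2 by ring.
rewrite big_cons; set S := \sum_(c <- b :: l) c ^+ 2.
transitivity (\int[nu]_x shifted_chi2_cdf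
    (Num.sqrt S :: nseq (size l) 0)%R (r - (x + a) ^+ 2)%R)%E.
  by apply: eq_integral => x _; exact: IH.
have S0 : 0 <= S by apply: sumr_ge0 => c _; exact: sqr_ge0.
rewrite /=; set rho := Num.sqrt S; set Q := shifted_chi2_cdf _.
have -> : S = rho ^+ 2 by rewrite sqr_sqrtr.
have t20 : 0 <= a ^+ 2 + rho ^+ 2 by rewrite addr_ge0 ?sqr_ge0.
set t := Num.sqrt _.
have t2E : t ^+ 2 = a ^+ 2 + rho ^+ 2 by rewrite sqr_sqrtr.
clearbody t rho; clear t20.
have [t0|tN0] := eqVneq t 0.
  have /andP[/eqP -> /eqP ->] : (a == 0) && (rho == 0).
    rewrite -(sqrf_eq0 a) -(sqrf_eq0 rho) -paddr_eq0 ?sqr_ge0//.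
    by rewrite -t2E t0 expr0n.
  by rewrite t0.
pose h (z : RT * RT) := Q (r - (z.1 + a) ^+ 2 - (z.2 + rho) ^+ 2).
have mh : measurable_fun setT h.
  apply: (measurableT_comp (measurable_shifted_chi2_cdf _)).
  by apply: measurable_funB; [apply: measurable_funB => //|];
    apply: measurable_funX; exact: measurable_funD.
have h01 z : (0 <= h z <= 1)%E by exact: shifted_chi2_cdf_le1.
(* The rotation with these entries sends (t, 0) to (a, rho). *)
have cs1 : (a / t) ^+ 2 + (- rho / t) ^+ 2 = 1.
  by rewrite !expr_div_n sqrrN -mulrDl -t2E divff// sqrf_eq0.
rewrite -[LHS](integral_normal_prob_rotation cs1 mh h01).
apply: eq_integral => x _; apply: eq_integral => y _; rewrite /h /=; congr Q.
move: cs1; set c := a / t; set s := - rho / t => cs1.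
have -> : a = c * t by rewrite /c; field.
have -> : rho = - s * t by rewrite /s; field.
transitivity (r - (c ^+ 2 + s ^+ 2) * ((x + t) ^+ 2 + y ^+ 2)); first by ring.
by rewrite cs1; ring.
Qed.

Lemma shifted_chi2_cdf_concentrate (l : seq R) (r : R) : (0 < size l)%N ->
  shifted_chi2_cdf l r = shifted_chi2_cdf
    (Num.sqrt (\sum_(b <- l) b ^+ 2) :: nseq (size l).-1 0) r.
Proof. by case: l => // a l _; exact: shifted_chi2_cdf_cons. Qed.

(** Links real integrals against the density to integrals against [nu]; each step moves the square
    of the first coordinate into the threshold. *)
Lemma gauss_iter_shifted_chi2_cdf (l : seq R) (x : R) :
  gauss_iter (size l) (fun s =>
    if \sum_(i < size l) (nth 0 s i + nth 0 l i) ^+ 2 <= x then 1 else 0) =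
  fine (shifted_chi2_cdf l x).
Proof.
elim: l x => [|a l IH] x /=; first by rewrite big_ord0.
rewrite /Rintegral; congr fine.
rewrite integral_normal_prob; last first.
  apply: integrable_le1 => [|z]; last exact: shifted_chi2_cdf_le1.
  exact: measurable_shifted_chi2_cdf_sub_sqr.
apply: eq_integral => z _.
rewrite mulrC EFinM; congr (_ * _)%E.
rewrite -[RHS]fineK ?shifted_chi2_cdf_fin_num// -IH; congr (gauss_iter _ _)%:E.
by apply/funext => s; rewrite big_ord_recl /= lerBrDl.
Qed.

Lemma ncchi2_cdfE (k : nat) (lambda x : R) : ncchi2_cdf k.+1 lambda x =
  fine (shifted_chi2_cdf (Num.sqrt lambda :: nseq k 0) x).
Proof.
rewrite -gauss_iter_shifted_chi2_cdf /= size_nseq.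
apply: eq_Rintegral => z _; congr (_ * gauss_iter _ _).
apply/funext => s; congr (if _ <= _ then _ else _).
apply: eq_bigr => -[[|i] /= ik] _ //.
by rewrite nth_nseq; case: ifP.
Qed.

End shifted_chi2.

(** * Independence of finite lists of random variables *)

Section seq_independence.
Context d (Omega : measurableType d) (R : realType) (P : probability Omega R).
Local Notation RT := (measurableTypeR R).
Implicit Types (Y Z W : {mfun Omega >-> RT}) (s : seq {mfun Omega >-> RT}).

(** Each variable travels with its measurable set, so an event is cut and permuted along with the
    list. *)
Definition cylinder
    (l : seq ({mfun Omega >-> RT} * {B : set RT | measurable B})) : set Omega :=
  \big[setI/setT]_(p <- l) (p.1 @^-1` sval p.2).

Definition seq_independent s := forall l, map fst l = s ->
  P (cylinder l) = (\big[*%E/1%E]_(p <- l) P (p.1 @^-1` sval p.2))%E.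

Lemma measurable_preimage_mfun Y (B : set RT) :
  measurable B -> measurable (Y @^-1` B).
Proof.
by move=> mB; rewrite -[X in measurable X]setTI; exact: measurable_funP.
Qed.

Lemma measurable_cylinder l : measurable (cylinder l).
Proof.
rewrite /cylinder; elim/big_ind: _ => //; first exact: measurableI.
by move=> p _; apply: measurable_preimage_mfun; case: (p.2).
Qed.

(** Brings to the head of the list the variables that are to be combined next. *)
Lemma seq_independent_catC s1 s2 :
  seq_independent (s1 ++ s2) -> seq_independent (s2 ++ s1).
Proof.
move=> ind l ls.
have lE : l = take (size s2) l ++ drop (size s2) l by rewrite cat_take_drop.
have := ind (drop (size s2) l ++ take (size s2) l).
rewrite map_cat map_drop map_take ls take_size_cat// drop_size_cat//.
rewrite /cylinder [in X in _ -> P X = _]lE [in X in _ -> _ = X]lE !big_cat /=.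
by rewrite setIC muleC; exact.
Qed.

(** Both sides are finite measures in [C] that agree on rectangles, so uniqueness of the product
    measure extends the factorization to all plane events. *)
Lemma pair_law Y1 Y2 (E : set Omega) : measurable E ->
  (forall A1 A2 : set RT, measurable A1 -> measurable A2 ->
    P (Y1 @^-1` A1 `&` (Y2 @^-1` A2 `&` E)) =
    (P (Y1 @^-1` A1) * (P (Y2 @^-1` A2) * P E))%E) ->
  forall C : set (RT * RT), measurable C ->
    P ((fun w => (Y1 w, Y2 w)) @^-1` C `&` E) =
    (P E * (distribution P Y1 \x distribution P Y2) C)%E.
Proof.
move=> mE prodE C mC.
have PE0 : 0 <= fine (P E) by rewrite fine_ge0.
have PEE : (fine (P E))%:E = P E by rewrite fineK// fin_num_measure.
(* Absorbing [P E] into the first marginal makes the right side a genuine product measure. *)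
pose m1 := mscale (NngNum PE0) (distribution P Y1).
have mY : measurable_fun setT (fun w => (Y1 w, Y2 w)).
  by apply/measurable_fun_pair; exact: measurable_funP.
pose m' := image_measure (mrestr P mE) mY.
have := @product_measure_unique _ _ _ _ _ m1 (distribution P Y2) m'.
rewrite -[LHS]/(m' C) => <- //.
  rewrite /product_measure1 ge0_integral_mscale//=; first by rewrite PEE.
  exact: measurable_fun_xsection.
move=> A B mA mB.
rewrite -[LHS]/(P ((fun w => (Y1 w, Y2 w)) @^-1` (A `*` B) `&` E)).
have -> : (fun w => (Y1 w, Y2 w)) @^-1` (A `*` B) =
  Y1 @^-1` A `&` Y2 @^-1` B by [].
rewrite -setIA prodE// -[RHS]/((fine (P E))%:E * P (Y1 @^-1` A) *
  P (Y2 @^-1` B))%E PEE.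
by rewrite [(P E * _)%E]muleC -muleA [(P E * _)%E]muleC.
Qed.

Lemma seq_independent_rect Y1 Y2 s l : seq_independent [:: Y1, Y2 & s] ->
  map fst l = s -> forall A1 A2 : set RT, measurable A1 -> measurable A2 ->
    P (Y1 @^-1` A1 `&` (Y2 @^-1` A2 `&` cylinder l)) =
    (P (Y1 @^-1` A1) * (P (Y2 @^-1` A2) * P (cylinder l)))%E.
Proof.
move=> ind ls.
have rect (A1 A2 : set RT) : measurable A1 -> measurable A2 ->
    P (Y1 @^-1` A1 `&` (Y2 @^-1` A2 `&` cylinder l)) =
    (P (Y1 @^-1` A1) * (P (Y2 @^-1` A2) *
      \big[*%E/1%E]_(p <- l) P (p.1 @^-1` sval p.2)))%E.
  move=> mA1 mA2.
  have := ind [:: (Y1, exist _ A1 mA1), (Y2, exist _ A2 mA2) & l].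
  by rewrite /cylinder !big_cons /= ls; exact.
(* Full sets for the first two variables identify the remaining product with [P (cylinder l)]. *)
have := rect setT setT measurableT measurableT.
rewrite !preimage_setT !setTI probability_setT !mul1e => ->.
exact: rect.
Qed.

Lemma seq_independent_law Y1 Y2 s (C : set (RT * RT)) :
  seq_independent [:: Y1, Y2 & s] -> measurable C ->
  P ((fun w => (Y1 w, Y2 w)) @^-1` C) =
  ((distribution P Y1 \x distribution P Y2) C)%E.
Proof.
move=> ind mC.
pose l : seq ({mfun Omega >-> RT} * {B : set RT | measurable B}) :=
  [seq (Y, exist _ setT measurableT) | Y <- s].
have ls : map fst l = s by rewrite -map_comp map_id.
have cylT : cylinder l = setT.
  by rewrite /cylinder big_map; apply: big1 => Y _; exact: preimage_setT.
have := pair_law (measurable_cylinder l) (seq_independent_rect ind ls) mC.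
by rewrite cylT setIT probability_setT mul1e.
Qed.

(** An event on [Z] is a plane event on the pair [Y1], [Y2], and [pair_law] separates such events
    from the rest of the list. *)
Lemma seq_independent_merge Y1 Y2 Z s (f : RT * RT -> RT) :
  measurable_fun setT f -> (forall w, Z w = f (Y1 w, Y2 w)) ->
  seq_independent [:: Y1, Y2 & s] -> seq_independent (Z :: s).
Proof.
move=> mf ZE ind [//|[_ B] l] /= [-> ls].
have mB : measurable (f @^-1` sval B).
  by rewrite -[X in measurable X]setTI; apply: mf => //; case: B.
have ZBE : Z @^-1` sval B = (fun w => (Y1 w, Y2 w)) @^-1` (f @^-1` sval B).
  by apply/seteqP; split => w /=; rewrite ZE.
rewrite /cylinder !big_cons /= -/(cylinder l) ZBE.
rewrite (pair_law (measurable_cylinder l) (seq_independent_rect ind ls) mB).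
rewrite -(seq_independent_law ind mB) muleC; congr (_ * _)%E.
have := ind
  [:: (Y1, exist _ setT measurableT), (Y2, exist _ setT measurableT) & l].
rewrite /cylinder !big_cons /= !preimage_setT !setTI probability_setT !mul1e ls.
exact.
Qed.

Lemma seq_independent_cst Z s (c : R) : (forall w, Z w = c) ->
  seq_independent s -> seq_independent (Z :: s).
Proof.
move=> Zc ind [//|[_ B] l] /= [-> ls]; rewrite /cylinder !big_cons /= -ind//.
have [cB|cB] := pselect (sval B c).
  have -> : Z @^-1` sval B = setT by apply/seteqP; split => w //= _; rewrite Zc.
  by rewrite setTI probability_setT mul1e.
have -> : Z @^-1` sval B = set0 by apply/seteqP; split => w //=; rewrite Zc.
by rewrite set0I measure0 mul0e.
Qed.

End seq_independence.

(** * Sums of independent normals and sums of their squares *)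

Section normal_laws.
Context d (Omega : measurableType d) (R : realType) (P : probability Omega R).
Local Notation RT := (measurableTypeR R).
Local Notation nu := (@normal_prob R 0 1).
Implicit Types (Y Z W : {mfun Omega >-> RT}) (s : seq {mfun Omega >-> RT}).

Definition normal_law (m t : R) Z :=
  forall B : set RT, measurable B -> P (Z @^-1` B) = normal_prob m t B.

Lemma ge0_integral_normal_law (m t : R) Z (f : RT -> \bar R) : 0 < t ->
  normal_law m t Z -> measurable_fun setT f -> (forall x, (0 <= f x)%E) ->
  (\int[distribution P Z]_x f x = \int[nu]_x f (m + t * x)%R)%E.
Proof.
move=> t0 lawZ mf f0; have mg := measurable_affine m t.
rewrite (eq_measure_integral (@image_measure _ _ RT RT _ nu _ mg)); last first.
  move=> A mA _; transitivity (normal_prob m t A); first exact: lawZ.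
  exact: normal_prob_affine.
by rewrite ge0_integral_pushforward.
Qed.

(** After standardization the centred sum is [t1 * x + t2 * y], which is [t] times the first
    coordinate of a rotated point, where [t] is the norm of (t1, t2). *)
Lemma normal_law_add (m1 t1 m2 t2 : R) Y1 Y2 Z s : 0 < t1 -> 0 < t2 ->
  normal_law m1 t1 Y1 -> normal_law m2 t2 Y2 ->
  (forall w, Z w = (Y1 w + Y2 w)%R) ->
  seq_independent P [:: Y1, Y2 & s] ->
  normal_law (m1 + m2) (Num.sqrt (t1 ^+ 2 + t2 ^+ 2)) Z.
Proof.
move=> t10 t20 law1 law2 ZE ind B mB.
have mp : measurable_fun setT (fun z : RT * RT => z.1 + z.2 : RT).
  exact: measurable_funD.
pose C := (fun z : RT * RT => z.1 + z.2 : RT) @^-1` B.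
have mC : measurable C by rewrite -[C]setTI; exact: mp.
have -> : Z @^-1` B = (fun w => (Y1 w, Y2 w)) @^-1` C.
  by apply/seteqP; split => w /=; rewrite ZE.
rewrite (seq_independent_law ind mC) /product_measure1.
rewrite (ge0_integral_normal_law t10 law1) //; last first.
  exact: measurable_fun_xsection.
set t := Num.sqrt _.
have tE : t ^+ 2 = t1 ^+ 2 + t2 ^+ 2 by rewrite sqr_sqrtr ?addr_ge0 ?sqr_ge0.
have t0 : 0 < t by rewrite sqrtr_gt0 addr_gt0 ?exprn_gt0.
have tN0 : t != 0 by rewrite gt_eqF.
clearbody t.
pose D := (fun x : RT => m1 + m2 + t * x : RT) @^-1` B.
have mD : measurable D.
  by rewrite -[D]setTI; exact: (measurable_affine (m1 + m2) t).
rewrite normal_prob_affine// -/D.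
(* [h] ignores its second coordinate, so its double integral is the measure of [D], while its
   rotated form describes the sum. *)
pose h (z : RT * RT) : \bar R := (\1_D z.1)%:E.
have mh : measurable_fun setT h.
  by apply: measurableT_comp => //; apply: measurableT_comp => //.
have h01 z : (0 <= h z <= 1)%E.
  by rewrite /h indicE !lee_fin ler0n lern1; case: (_ \in _).
have cs1 : (t1 / t) ^+ 2 + (t2 / t) ^+ 2 = 1.
  by rewrite !expr_div_n -mulrDl -tE divff// sqrf_eq0.
have := integral_normal_prob_rotation cs1 mh h01.
rewrite /h /=.
under [X in _ = X -> _]eq_integral => x _.
  rewrite integral_cst// [X in (_ * X)%E]probability_setT mule1; over.
rewrite integral_indic// setIT => <-.
apply: eq_integral => x _; rewrite /=.
rewrite -[LHS]/(P (Y2 @^-1` xsection C (m1 + t1 * x))).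
have mS := measurable_xsection (m1 + t1 * x) mC.
rewrite law2// normal_prob_affine//.
set S := _ @^-1` _.
have mS' : measurable S.
  by rewrite -[S]setTI; exact: (measurable_affine m2 t2).
transitivity (\int[nu]_y (\1_S y)%:E)%E.
  by rewrite integral_indic// setIT.
apply: eq_integral => y _; rewrite !indicE; congr (_%:R)%:E.
congr (nat_of_bool _); apply/idP/idP; rewrite !inE /S /D /= xsectionP /C /=.
  by have -> : m1 + m2 + t * (t1 / t * x + t2 / t * y) =
    m1 + t1 * x + (m2 + t2 * y) by field.
by have -> : m1 + m2 + t * (t1 / t * x + t2 / t * y) =
  m1 + t1 * x + (m2 + t2 * y) by field.
Qed.

Lemma exists_mfun (f : Omega -> RT) : measurable_fun setT f ->
  exists Z, forall w, Z w = f w.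
Proof.
by move=> mf; exists (@mfun_Sub _ _ Omega RT _ (mem_set mf)).
Qed.

(** The accumulator [Y] starts the sum with a nondegenerate normal: an empty sum would have
    deviation zero. *)
Lemma normal_law_sum (K : Type) (X : K -> {mfun Omega >-> RT}) (ks : seq K)
    (Y : {mfun Omega >-> RT}) s (m1 t1 m t : R) : 0 < t1 -> 0 < t ->
  normal_law m1 t1 Y -> (forall k, normal_law m t (X k)) ->
  seq_independent P (Y :: map X ks ++ s) ->
  exists Z, [/\ forall w, Z w = (Y w + \sum_(k <- ks) X k w)%R,
    seq_independent P (Z :: s) &
    normal_law (m1 + m *+ size ks)
      (Num.sqrt (t1 ^+ 2 + t ^+ 2 *+ size ks)) Z].
Proof.
move=> + t0 + lawX; elim: ks Y m1 t1 => [|k ks IH] Y m1 t1 t10 lawY ind.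
  exists Y; split; [by move=> w; rewrite big_nil addr0|exact: ind|].
  by rewrite !mulr0n !addr0 sqrtr_sqr gtr0_norm.
have mp : measurable_fun setT (fun z : RT * RT => z.1 + z.2 : RT).
  exact: measurable_funD.
have mS : measurable_fun setT (fun w => Y w + X k w : RT).
  apply: (measurableT_comp mp (g := fun w => (Y w, X k w))).
  by apply/measurable_fun_pair; exact: measurable_funP.
have [Y' Y'E] := exists_mfun mS.
have ind' := seq_independent_merge mp Y'E ind.
have lawY' := normal_law_add t10 t0 lawY (lawX k) Y'E ind.
have tt0 : 0 < Num.sqrt (t1 ^+ 2 + t ^+ 2).
  by rewrite sqrtr_gt0 addr_gt0 ?exprn_gt0.
have [Z [ZE indZ lawZ]] := IH _ _ _ tt0 lawY' ind'.
exists Z; split; [by move=> w; rewrite ZE Y'E big_cons addrA|exact: indZ|].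
have -> : m1 + m *+ (size (k :: ks)) = m1 + m + m *+ size ks.
  by rewrite /= mulrS addrA.
have -> : t1 ^+ 2 + t ^+ 2 *+ (size (k :: ks)) =
    Num.sqrt (t1 ^+ 2 + t ^+ 2) ^+ 2 + t ^+ 2 *+ size ks.
  by rewrite sqr_sqrtr ?addr_ge0 ?sqr_ge0// /= mulrS addrA.
exact: lawZ.
Qed.

Lemma measurable_affine_sqr_add (b c : R) : measurable_fun setT
  (fun z : RT * RT => (b + c * z.1) ^+ 2 + z.2 : RT).
Proof.
apply: measurable_funD => //; apply: measurable_funX.
by apply: measurable_funD => //; exact: measurable_funM.
Qed.

(** Since [c * t = 1], the variable [b + c * Z] is normal with mean [b + c * m] and unit variance;
    integrating over [Z] first gives the recursion of [shifted_chi2_cdf]. *)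
Lemma shifted_chi2_law_add (l : seq R) (m t b c r : R) Z W W' s :
  0 < t -> c * t = 1 -> normal_law m t Z ->
  (forall r, P [set w | W w <= r] = shifted_chi2_cdf l r) ->
  (forall w, W' w = (b + c * Z w) ^+ 2 + W w) ->
  seq_independent P [:: Z, W & s] ->
  P [set w | W' w <= r] = shifted_chi2_cdf (b + c * m :: l) r.
Proof.
move=> t0 ct1 lawZ lawW W'E ind.
pose C := [set z : RT * RT | (b + c * z.1) ^+ 2 + z.2 <= r].
have mC : measurable C.
  have -> : C =
      (fun z : RT * RT => (b + c * z.1) ^+ 2 + z.2 : RT) @^-1` `]-oo, r].
    by apply/seteqP; split => z /=; rewrite in_itv.
  have mp := measurable_affine_sqr_add b c.
  rewrite -[X in measurable X]setTI; apply: mp => //; exact: measurable_itv.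
have -> : [set w | W' w <= r] = (fun w => (Z w, W w)) @^-1` C.
  by apply/seteqP; split => w /=; rewrite W'E.
rewrite (seq_independent_law ind mC) /product_measure1.
rewrite (ge0_integral_normal_law t0 lawZ) //; last first.
  exact: measurable_fun_xsection.
apply: eq_integral => x _.
rewrite -[LHS]/(P (W @^-1` xsection C (m + t * x))).
apply: etrans (lawW (r - (x + (b + c * m)) ^+ 2)); congr (P _); apply/seteqP.
have E : b + c * (m + t * x) = x + (b + c * m).
  by transitivity (b + c * m + c * t * x); [ring|rewrite ct1; ring].
by split => w; rewrite /= xsectionE /C /= E lerBrDl.
Qed.

(** Induction on the blocks indexed by [js]; the spare list [s] lets the sum of one block wait while
    the later blocks are processed. *)
Lemma shifted_chi2_law_sum (J K : Type) (X : J -> K -> {mfun Omega >-> RT})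
    (k0 : K) (ks : seq K) (m t b c : J -> R) (js : seq J) s :
  (forall j, 0 < t j) ->
  (forall j, c j * Num.sqrt (t j ^+ 2 *+ (size ks).+1) = 1) ->
  (forall j k, normal_law (m j) (t j) (X j k)) ->
  seq_independent P (flatten [seq map (X j) (k0 :: ks) | j <- js] ++ s) ->
  exists W, [/\ forall w, W w =
      \sum_(j <- js) (b j + c j * \sum_(k <- k0 :: ks) X j k w) ^+ 2,
    seq_independent P (W :: s) &
    forall r, P [set w | W w <= r] = shifted_chi2_cdf
      [seq b j + c j * (m j *+ (size ks).+1) | j <- js] r].
Proof.
move=> t0 ct1 lawX; elim: js s => [|j js IH] s ind.
  have [W WE] := exists_mfun (measurable_cst (0 : RT)).
  exists W; split => [w||r]; first by rewrite WE big_nil.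
    exact: (seq_independent_cst WE).
  have [r0|r0] := leP 0 r; rewrite /= ?r0.
    rewrite -[RHS](@probability_setT _ _ _ P); congr (P _).
    by apply/seteqP; split => w //= _; rewrite WE.
  rewrite leNgt r0 -[RHS](@measure0 _ _ _ P); congr (P _).
  by apply/seteqP; split => w //=; rewrite WE leNgt r0.
have {}ind : seq_independent P (X j k0 :: map (X j) ks ++
    (flatten [seq map (X j) (k0 :: ks) | j <- js] ++ s)).
  by rewrite catA; exact: ind.
have [Z [ZE indZ lawZ]] :=
  normal_law_sum (t0 j) (t0 j) (lawX j k0) (lawX j) ind.
(* The block sum [Z] is parked at the end of the list, and returns to the front once [W] has been
   built from the other blocks. *)
have indZ' : seq_independent P
    (flatten [seq map (X j) (k0 :: ks) | j <- js] ++ (s ++ [:: Z])).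
  by rewrite catA; apply: (@seq_independent_catC _ _ _ _ [:: Z]).
have [W [WE indW lawW]] := IH _ indZ'.
have indZW : seq_independent P [:: Z, W & s].
  exact: (@seq_independent_catC _ _ _ _ (W :: s) [:: Z]).
have mp := measurable_affine_sqr_add (b j) (c j).
have mS : measurable_fun setT (fun w => (b j + c j * Z w) ^+ 2 + W w : RT).
  apply: (measurableT_comp mp (g := fun w => (Z w, W w))).
  by apply/measurable_fun_pair; exact: measurable_funP.
have [W' W'E] := exists_mfun mS.
exists W'; split.
- by move=> w; rewrite W'E WE ZE !big_cons.
- exact: (seq_independent_merge mp W'E indZW).
- move=> r; rewrite map_cons mulrS.
  apply: (shifted_chi2_law_add r _ _ lawZ lawW W'E indZW) => //.
    by rewrite sqrtr_gt0 -mulrS pmulrn_lgt0 ?exprn_gt0.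
  by rewrite -mulrS.
Qed.

End normal_laws.

(** * From indexed families to lists *)

Section mutual_independence.
Context d (Omega : measurableType d) (R : realType) (P : probability Omega R).
Local Notation RT := (measurableTypeR R).

(** Reindexes by position in [r]; [op] is arbitrary so as to cover both intersections of events and
    products of probabilities. *)
Lemma big_zip_index (T S U : Type) (op : U -> U -> U) (idx : U) (I : eqType)
    (f : I -> T) (F : T -> S -> U) (x0 : S) (r : seq I) (l : seq (T * S)) :
  uniq r -> map fst l = map f r ->
  \big[op/idx]_(p <- l) F p.1 p.2 =
  \big[op/idx]_(i <- r) F (f i) (nth x0 (map snd l) (index i r)).
Proof.
elim: r l => [|i r IH] [|[t x] l] //=; first by rewrite !big_nil.
move=> /andP[ir ur] [-> lr]; rewrite !big_cons /= eqxx (IH _ ur lr).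
congr op; apply: eq_big_seq => j jr.
by case: eqP => [ij|//]; rewrite ij jr in ir.
Qed.

Lemma mutually_independent_seq (I : finType) (Y : I -> {mfun Omega >-> RT})
    (r : seq I) : uniq r ->
  mutually_independent P (fun i => Y i : Omega -> R) ->
  seq_independent P (map Y r).
Proof.
move=> ur ind l lr; rewrite /cylinder.
pose T0 : {B : set RT | measurable B} := exist _ setT measurableT.
pose B i := sval (nth T0 (map snd l) (index i r)).
rewrite (big_zip_index setI setT
  (fun (Z : {mfun Omega >-> RT}) C => Z @^-1` sval C) T0 ur lr).
rewrite (big_zip_index *%E 1%E
  (fun (Z : {mfun Omega >-> RT}) C => P (Z @^-1` sval C)) T0 ur lr).
(* For an index outside [r] the lookup runs past the end and returns the default [T0], the whole
   line, so no condition is imposed. *)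
have BT i : i \notin r -> B i = setT.
  move=> ir; rewrite /B nth_default// size_map -(size_map fst) lr size_map.
  by rewrite leqNgt index_mem.
have mB i : measurable (B i : set R) by rewrite /B; case: (nth _ _ _).
rewrite (big_uniq _ ur) big_mkcond [RHS](big_uniq _ ur) [RHS]big_mkcond /=.
transitivity (P (\bigcap_(i in [set: I]) (Y i @^-1` B i))); last first.
  rewrite (ind B mB); apply: eq_bigr => i _; case: ifPn => // ir.
  by rewrite BT// preimage_setT probability_setT.
congr (P _); rewrite -big_enum /= -bigcap_seq; apply/seteqP.
split => w wY i /= _; last by have := wY i Logic.I; case: ifP.
have := wY i; rewrite /= mem_enum => /(_ isT).
by case: ifPn => // ir _; rewrite BT.
Qed.

End mutual_independence.

(** * Completing the square in the log likelihood ratio *)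

Section log_likelihood_ratio.
Context {R : realType}.

(** The j-th square is that of [sqrt n * (N j - (z j - mu j)) / sigma j], in which [mu] cancels. *)
Lemma logLR_ge_iff (Omega : Type) (T n dim : nat)
    (X : 'I_T -> 'I_n -> 'I_dim -> Omega -> R) (mu sigma z : 'I_dim -> R)
    (tau : 'I_T) (gamma : R) (w : Omega) : (2 <= n)%N ->
  (forall j, 0 < sigma j) ->
  (gamma <= logLR X mu sigma z tau w) =
  (\sum_(j < dim) (- (Num.sqrt n%:R * z j / sigma j) +
      (Num.sqrt n%:R * sigma j)^-1 * \sum_(k < n) X tau k j w) ^+ 2 <=
   n%:R * Rsq n dim (mstar sigma mu z) gamma).
Proof.
move=> n2 sigma0; rewrite /logLR /Rsq; set N := N_tau _ _ _ _.
set L := ln _; set m := mstar _ _ _.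
have n0 : 0 < n%:R :> R by rewrite ltr0n (leq_trans _ n2).
have n1 : 0 < n%:R - 1 :> R by rewrite subr_gt0 ltr1n.
set q := diag_form sigma N N; set p := diag_form sigma N _.
have -> : \sum_(j < dim) (- (Num.sqrt n%:R * z j / sigma j) +
      (Num.sqrt n%:R * sigma j)^-1 * \sum_(k < n) X tau k j w) ^+ 2 =
    n%:R * (q - 2 * p + m).
  rewrite /q /p /m /mstar /diag_form mulr_sumr -sumrB -big_split /= mulr_sumr.
  apply: eq_bigr => j _; rewrite /N /N_tau; set S := \sum_(k < n) _.
  have sn0 : Num.sqrt n%:R != 0 :> R by rewrite sqrtr_eq0 -ltNge.
  have sj0 : sigma j != 0 by rewrite gt_eqF.
  have nE : n%:R = Num.sqrt n%:R ^+ 2 :> R by rewrite sqr_sqrtr// ltW.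
  move: (Num.sqrt n%:R) sn0 nE => u u0 ->.
  by field; rewrite sj0 u0.
move: n0 n1; move: (n%:R : R) => x x0 x1.
rewrite -subr_ge0 -[in RHS]subr_ge0.
(* The gap in the quadratic inequality is [2 * (n - 1)] times the gap between [logLR] and [gamma], a
   positive factor as [n] is at least 2. *)
have -> : x * (2 * (x - 1) / x * (m / 2 - gamma - dim%:R / 2 * L)) -
    x * (q - 2 * p + m) =
  2 * (x - 1) * (- (dim%:R / 2) * L - x / (2 * (x - 1)) * q +
    x / (x - 1) * p - m / (2 * (x - 1)) - gamma).
  by field; rewrite !gt_eqF.
by rewrite pmulr_rge0// mulr_gt0.
Qed.

End log_likelihood_ratio.

Theorem corollaryB6 (R : realType) (d0 : measure_display) (Omega : measurableType d0)
  (P : probability Omega R) (T n dim : nat) (hT : (1 <= T)%N) (hn : (2 <= n)%N)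
  (hd : (1 <= dim)%N) (tau : 'I_T) (mu sigma z : 'I_dim -> R)
  (hsigma : forall j, 0 < sigma j)
  (X : 'I_T -> 'I_n -> 'I_dim -> Omega -> R)
  (hXmeas : forall t k j, measurable_fun setT (X t k j))
  (hXlaw : forall t k j (B : set R), measurable B ->
     P (X t k j @^-1` B) = normal_prob (mu j) (sigma j) B)
  (hXind : mutually_independent P
     (fun i : 'I_T * 'I_n * 'I_dim => X i.1.1 i.1.2 i.2))
  (gamma : R) (hgamma : gamma <= gamma_max n dim (mstar sigma mu z)) :
  P [set w | gamma <= logLR X mu sigma z tau w] =
  (ncchi2_cdf dim (n%:R * mstar sigma mu z)
     (n%:R * Rsq n dim (mstar sigma mu z) gamma))%:E.
Proof.
pose RT := measurableTypeR R.
pose Y j k : {mfun Omega >-> RT} :=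
  @mfun_Sub _ _ Omega RT _ (mem_set (hXmeas tau k j)).
pose Yall (i : 'I_T * 'I_n * 'I_dim) : {mfun Omega >-> RT} :=
  @mfun_Sub _ _ Omega RT _ (mem_set (hXmeas i.1.1 i.1.2 i.2)).
have n0 : (0 < n)%N by rewrite (leq_trans _ hn).
have nR0 : 0 < n%:R :> R by rewrite ltr0n.
(* The first observation serves as the start of each coordinate sum. *)
have [k0 [ks enumE]] : exists k0 ks, enum 'I_n = k0 :: ks.
  case E : (enum 'I_n) => [|k0 ks]; last by exists k0, ks.
  by have := size_enum_ord n; rewrite E /= => n00; rewrite -n00 in n0.
have size_ks : (size ks).+1 = n.
  by rewrite -[LHS]/(size (k0 :: ks)) -enumE size_enum_ord.
have indY : seq_independent P
    (flatten [seq map (Y j) (k0 :: ks) | j <- enum 'I_dim] ++ [::]).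
  rewrite cats0 -enumE.
  have -> : flatten [seq map (Y j) (enum 'I_n) | j <- enum 'I_dim] =
      map Yall [seq (tau, k, j) | j <- enum 'I_dim, k <- enum 'I_n].
    by elim: (enum 'I_dim) => //= j js ->; rewrite map_cat -map_comp.
  apply: mutually_independent_seq; last exact: hXind.
  by apply: allpairs_uniq; rewrite ?enum_uniq// => -[j k] [j' k'] _ _ [-> ->].
(* [c j] is the inverse standard deviation of the sum of the [n] observations of coordinate [j];
   [b j] recentres that sum at the target. *)
pose c j := (Num.sqrt n%:R * sigma j)^-1.
pose b j := - (Num.sqrt n%:R * z j / sigma j).
have sn0 : 0 < Num.sqrt n%:R :> R by rewrite sqrtr_gt0.
have cE j : c j * Num.sqrt (sigma j ^+ 2 *+ (size ks).+1) = 1.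
  rewrite size_ks -mulr_natl sqrtrM ?ltW// sqrtr_sqr gtr0_norm// mulVf//.
  by rewrite gt_eqF// mulr_gt0.
have lawY j k : normal_law P (mu j) (sigma j) (Y j k).
  by move=> B mB; exact: hXlaw.
have [W [WE _ lawW]] := shifted_chi2_law_sum b hsigma cE lawY indY.
have WE' w : W w = \sum_(j < dim) (b j + c j * \sum_(k < n) X tau k j w) ^+ 2.
  rewrite WE -enumE.
  by rewrite big_enum; apply: eq_bigr => j _; rewrite big_enum.
have -> : [set w | gamma <= logLR X mu sigma z tau w] =
    [set w | W w <= n%:R * Rsq n dim (mstar sigma mu z) gamma].
  by apply/seteqP; split => w /=; rewrite WE' logLR_ge_iff.
rewrite lawW shifted_chi2_cdf_concentrate size_map size_enum_ord//.
rewrite big_map big_enum /= size_ks.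
(* The shift of coordinate [j] is [sqrt n * (mu j - z j) / sigma j], so the squared norm is the
   announced non-centrality. *)
have -> : \sum_(j < dim) (b j + c j * (mu j *+ n)) ^+ 2 =
    n%:R * mstar sigma mu z.
  rewrite /mstar /diag_form mulr_sumr; apply: eq_bigr => j _.
  rewrite /b /c -(mulr_natr (mu j)).
  have nE : n%:R = Num.sqrt n%:R ^+ 2 :> R by rewrite sqr_sqrtr// ltW.
  have sj0 : sigma j != 0 by rewrite gt_eqF.
  have sn1 : Num.sqrt n%:R != 0 :> R by rewrite gt_eqF.
  move: (Num.sqrt n%:R) sn1 nE => u u0 ->.
  by field; rewrite sj0 u0.
have -> (lambda x : R) : ncchi2_cdf dim lambda x =
    fine (shifted_chi2_cdf (Num.sqrt lambda :: nseq dim.-1 0) x).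
  by rewrite -ncchi2_cdfE prednK.
by rewrite fineK// shifted_chi2_cdf_fin_num.
Qed.
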